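(* There is a constant $c > 0$ such that for each sufficiently large $\Delta$, there is a $3$-uniform hypergraph $H$ with maximum degree at most $\Delta$ for which the $4$-colour Ramsey number of $H$ satisfies \[ r(H,H,H,H) \ge 2^{2^{c\Delta}}\, n, \] where $n$ is the number of vertices of $H$.
   Context: A hypergraph is $3$-uniform if every edge has exactly $3$ vertices. The degree of a vertex is the number of edges containing it, and the maximum degree is the largest degree of a vertex. The $4$-colour Ramsey number $r(H,H,H,H)$ is the minimum $N$ such that every $4$-colouring of the edges of the complete $3$-uniform hypergraph on $N$ vertices contains a monochromatic copy of $H$ (a not necessarily induced subhypergraph isomorphic to $H$). *)

(* Defs.v *)
From mathcomp Require Import all_boot.

Set Implicit Arguments.
Unset Strict Implicit.
Unset Printing Implicit Defensive.

Record hypergraph3 (V : finType) := Hypergraph3 {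
  edges : {set {set V}};
  edges_uniform : forall e, e \in edges -> #|e| = 3 }.

Definition degree (V : finType) (H : hypergraph3 V) (v : V) : nat :=
  #|[set e in edges H | v \in e]|.

Definition max_degree (V : finType) (H : hypergraph3 V) : nat :=
  \max_(v : V) degree H v.

(* A 4-colouring of the edges of the complete 3-uniform hypergraph on 'I_N is
   represented by a colouring of all subsets of 'I_N; as the edges of H have
   3 vertices and f is injective, only its values on triples are ever used. *)
Definition mono_copy (V : finType) (H : hypergraph3 V) (N : nat)
    (c : {ffun {set 'I_N} -> 'I_4}) : bool :=
  [exists f : {ffun V -> 'I_N}, injectiveb f &&
    [exists a : 'I_4, [forall e in edges H, c (f @: e) == a]]].

Definition arrows4 (V : finType) (H : hypergraph3 V) (N : nat) : bool :=
  [forall c : {ffun {set 'I_N} -> 'I_4}, mono_copy H c].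

Lemma ramsey_uniform (C : finType) (k m : nat) : exists N : nat,
  forall (T : finType) (A : {set T}) (c : {set T} -> C), N <= #|A| ->
  exists (a : C) (B : {set T}), [/\ B \subset A, m <= #|B| &
    forall e : {set T}, e \subset B -> #|e| = k -> c e = a].
Proof.
elim: k m => [|k IHk] m.
  exists m => T A c leA; exists (c set0), A; split=> // e _ /eqP.
  by rewrite cards_eq0 => /eqP->.
suff offdiag n : exists N : nat, forall q : C -> nat, \sum_a q a = n ->
    forall (T : finType) (A : {set T}) (c : {set T} -> C), N <= #|A| ->
    exists (a : C) (B : {set T}), [/\ B \subset A, q a <= #|B| &
      forall e : {set T}, e \subset B -> #|e| = k.+1 -> c e = a].
  have [N HN] := offdiag (\sum_(a : C) m).
  by exists N => T A c; apply: (HN (fun=> m)).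
have small (q : C -> nat) (T : finType) (A : {set T}) (c : {set T} -> C) a :
    q a = 0 -> exists (a : C) (B : {set T}), [/\ B \subset A, q a <= #|B| &
      forall e : {set T}, e \subset B -> #|e| = k.+1 -> c e = a].
  move=> qa0; exists a, set0; split; rewrite ?sub0set ?qa0 // => e.
  by rewrite subset0 => /eqP->; rewrite cards0.
elim: n => [|n [N IHn]].
  exists 0 => q /eqP; rewrite sum_nat_eq0 => /forallP q0 T A c _.
  exact/(small q T A c (c set0))/eqP/q0.
have [M HM] := IHk N; exists M.+1 => q sumq T A c leA.
have /card_gt0P[x xA] : 0 < #|A| by apply: leq_trans leA.
have leA' : M <= #|A :\ x| by rewrite (cardsD1 x A) xA add1n ltnS in leA.
have [a [B [sBA leB homB]]] := HM T _ (fun e => c (x |: e)) leA'.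
have [qa0|qa_gt0] := posnP (q a); first exact: small qa0.
pose q' b := if b == a then (q b).-1 else q b.
have sumq' : \sum_b q' b = n.
  apply: succn_inj; rewrite -sumq (bigD1 a) //= [RHS](bigD1 a) //= /q' eqxx.
  rewrite -addSn prednK //; congr (_ + _).
  by apply: eq_bigr => b /negPf->.
have [b [D [sDB leD homD]]] := IHn q' sumq' T B c leB.
have sBA' : B \subset A by apply: subset_trans sBA (subD1set _ _).
have [eab|neab] := eqVneq b a; last first.
  exists b, D; split=> //; first exact: subset_trans sDB sBA'.
  by move: leD; rewrite /q' (negPf neab).
move: leD homD; rewrite /q' eab eqxx => leD homD.
have xD : x \notin D.
  by apply/negP => /(subsetP sDB)/(subsetP sBA); rewrite !inE eqxx.
exists a, (x |: D); split.
- by rewrite subUset sub1set xA (subset_trans sDB).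
- by rewrite cardsU1 xD add1n -(prednK qa_gt0) ltnS.
move=> e sexD ek; have [xe|xe] := boolP (x \in e); last first.
  apply: homD => //; apply/subsetP => y ye.
  have := subsetP sexD y ye; rewrite !inE => /orP[/eqP yx|//].
  by rewrite -yx ye in xe.
rewrite -(setD1K xe); apply: homB.
  by apply: subset_trans sDB; rewrite subDset.
by move: ek; rewrite (cardsD1 x e) xe add1n => -[].
Qed.

Lemma arrows4_ex (V : finType) (H : hypergraph3 V) : exists N, arrows4 H N.
Proof.
have [N HN] := ramsey_uniform 'I_4 3 #|V|.
exists N; apply/forallP => c.
have [|a [B [_ leB homB]]] := HN 'I_N setT c; first by rewrite cardsT card_ord.
pose g (v : V) : 'I_N := enum_val (widen_ord leB (enum_rank v)).
have g_inj : injective g.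
  move=> u v /enum_val_inj/(congr1 val) /= /ord_inj; exact: enum_rank_inj.
apply/existsP; exists [ffun v => g v]; apply/andP; split.
  by apply/injectiveP => u v; rewrite !ffunE; apply: g_inj.
apply/existsP; exists a; apply/forall_inP => e eH; apply/eqP/homB.
  by apply/subsetP => _ /imsetP[v _ ->]; rewrite ffunE; apply: enum_valP.
rewrite card_imset; first exact: (edges_uniform eH).
by move=> u v; rewrite !ffunE; apply: g_inj.
Qed.

Definition ramsey4 (V : finType) (H : hypergraph3 V) : nat :=
  ex_minn (arrows4_ex H).

(* Main.v *)
Require Import Defs.
From mathcomp Require Import all_boot all_order all_algebra.
From mathcomp Require Import zify.

(* The hypergraph has q disjoint pairs of vertices, and its edges are a pair
   together with any further vertex, so that degrees are linear in q.  The
   colouring of the triples x < y < z below 2 ^ N is the Erdos-Hajnal stepping-up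
   colouring: it records chi {d(x, y), d(y, z)} and whether d(x, y) < d(y, z),
   where d is the branching level in the binary tree and chi a 2-colouring of
   pairs of levels without large monochromatic cliques.  In a monochromatic copy
   with d(x, y) < d(y, z) throughout, every vertex outside a pair is either to
   the right of the branching node of the pair or in its left subtree.  The q
   branching nodes thus lie on one path, and their levels form a monochromatic
   q-clique of chi. *)

Set Implicit Arguments.
Unset Strict Implicit.
Unset Printing Implicit Defensive.

(** * A colouring of pairs without large monochromatic cliques *)

(** Union bound: an injective [g] and a colour [b] prescribe [chi] on [e = q * (k + 1)] sets, so
    they spoil a fraction [1 / 2 ^ e] of all colourings, and there are at most [2 ^ (k * q + 1)]
    choices of [(g, b)]. *)
Lemma ramsey2_lower_bound (k : nat) :
  exists chi : {ffun {set 'I_(2 ^ k)} -> bool},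
    forall (g : {ffun 'I_(2 * k + 3) -> 'I_(2 ^ k)}) (b : bool), injective g ->
      ~ (forall i j, i != j -> chi [set g i; g j] = b).
Proof.
set q := 2 * k + 3; set N := 2 ^ k.
pose D (g : {ffun 'I_q -> 'I_N}) := [set B : {set 'I_N} | B \subset g @: 'I_q & #|B| == 2].
pose mono (p : {ffun 'I_q -> 'I_N} * bool) : {set {ffun {set 'I_N} -> bool}} :=
  [set chi : {ffun {set 'I_N} -> bool} | injectiveb p.1 & [forall B in D p.1, chi B == p.2]].
pose S := 2 ^ N; pose e := 'C(q, 2).
have cardS : S = #|{: {set 'I_N}}|.
  by rewrite -cardsT -powersetT card_powerset cardsT card_ord.
have card_mono p : #|mono p| * 2 ^ e <= 2 ^ S.
  have [inj|ninj] := boolP (injectiveb p.1); last first.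
    rewrite (_ : mono p = set0) ?cards0 //.
    by apply/setP => chi; rewrite !inE (negPf ninj).
  have cardD : #|D p.1| = e.
    by rewrite cards_draws card_imset ?card_ord //; apply/injectiveP.
  pose F (B : {set 'I_N}) := if B \in D p.1 then pred1 p.2 else predT.
  have sub : mono p \subset family F.
    apply/subsetP => chi; rewrite inE inj => /forall_inP h.
    apply/familyP => B; rewrite /F; case: ifP => // /h.
    by rewrite !inE.
  apply: leq_trans (leq_mul (subset_leq_card sub) (leqnn _)) _.
  rewrite card_family foldrE big_map big_enum /=.
  rewrite (bigID (mem (D p.1))) /= big1 ?mul1n; last first.
    by move=> B hB; rewrite /F hB card1.
  rewrite (eq_bigr (fun=> 2)); last first.
    by move=> B /negPf hB; rewrite /F hB card_bool.
  rewrite prod_nat_const -expnD leq_exp2l //.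
  rewrite cardS.
  rewrite -cardD addnC -(cardC (mem (D p.1))) leq_add2l.
  by apply: subset_leq_card; apply/subsetP.
have /existsP [chi /forallP chiP] : [exists chi, forall p, chi \notin mono p].
  apply: contraT; rewrite negb_exists => /forallP h.
  have cover : [set: {ffun {set 'I_N} -> bool}] \subset \bigcup_p mono p.
    apply/subsetP => chi _; apply/bigcupP.
    have := h chi; rewrite negb_forall => /existsP [p].
    by rewrite negbK; exists p.
  have := subset_leq_card cover; rewrite cardsT card_ffun card_bool -cardS => {}cover.
  have H : 2 ^ S <= \sum_p #|mono p|.
    apply: leq_trans cover _; elim/big_rec2: _ => [|p A n _ le].
      by rewrite cards0.
    by apply: leq_trans (leq_card_setU _ _) _; rewrite leq_add2l.
  have : 2 ^ S * 2 ^ e <= N ^ q * 2 * 2 ^ S.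
    apply: leq_trans (leq_mul H (leqnn _)) _.
    rewrite big_distrl /=.
    apply: (@leq_trans (\sum_(p : {ffun 'I_q -> 'I_N} * bool) 2 ^ S)).
      exact: leq_sum.
    by rewrite sum_nat_const card_prod card_ffun card_bool !card_ord.
  rewrite mulnC leq_pmul2r ?expn_gt0 // /N -expnM -expnSr leq_exp2l //.
  by rewrite /e bin2 /q; nia.
exists chi => g b inj h; have := chiP (g, b); rewrite inE => /negP; apply.
apply/andP; split; first exact/injectiveP.
apply/forall_inP => B; rewrite inE => /andP [/subsetP sB /cards2P [x [y [xy eB]]]].
have /imsetP [i _ ei] : x \in g @: 'I_q by apply: sB; rewrite eB !inE eqxx.
have /imsetP [j _ ej] : y \in g @: 'I_q by apply: sB; rewrite eB !inE eqxx orbT.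
rewrite eB ei ej h //=; apply: contraNneq xy => ij.
by rewrite ei ej ij.
Qed.

(** * Branching levels in the binary tree *)

Lemma div2_expn_eventually (x y : nat) : exists k, x %/ 2 ^ k == y %/ 2 ^ k.
Proof.
exists (x + y); have h := @ltn_expl 2 (x + y) isT.
by rewrite !divn_small //; lia.
Qed.

(* One plus the position of the most significant binary digit at which
   [x] and [y] differ, and [0] if [x = y]. *)
Definition split_level (x y : nat) : nat := ex_minn (div2_expn_eventually x y).

(** Quotients that agree for [2 ^ m] agree for all higher powers, so the minimum is a threshold. *)
Lemma ltn_split_level (k x y : nat) :
  (k < split_level x y) = (x %/ 2 ^ k != y %/ 2 ^ k).
Proof.
rewrite /split_level; case: ex_minnP => m /eqP hm min.
apply/idP/idP => [km|]; first by apply: contraTN km => /min; rewrite -leqNgt.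
apply: contraNltn => mk; rewrite -(subnKC mk) expnD !divnMA hm //.
Qed.

Lemma split_levelC (x y : nat) : split_level x y = split_level y x.
Proof.
by apply/eqP; rewrite eqn_leq; apply/andP; split; rewrite leqNgt ltn_split_level;
  rewrite eq_sym -ltn_split_level ltnn.
Qed.

(** Division by [2 ^ k] is monotone, so the quotients of [x] and [z] agree exactly when that of [y]
    agrees with both. *)
Lemma split_level_max (x y z : nat) : x < y -> y < z ->
  split_level x z = maxn (split_level x y) (split_level y z).
Proof.
move=> xy yz; have E k : (k < split_level x z) =
    (k < maxn (split_level x y) (split_level y z)).
  rewrite leq_max !ltn_split_level.
  have := leq_div2r (2 ^ k) (ltnW xy); have := leq_div2r (2 ^ k) (ltnW yz).
  lia.
apply/eqP; rewrite eqn_leq; apply/andP; split; rewrite leqNgt.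
  by rewrite E ltnn.
by rewrite -E ltnn.
Qed.

(* Three numbers agreeing above one binary digit take only two values there. *)
Lemma split_level_neq (x y z : nat) : x < y -> y < z ->
  split_level x y != split_level y z.
Proof.
move=> xy yz; apply/eqP => e.
have : 0 < split_level x y by rewrite ltn_split_level !divn1; lia.
case d : (split_level x y) => [//|k] _.
have h1 : k < split_level x y by rewrite d.
have h2 : k < split_level y z by rewrite -e d.
have h3 : ~~ (k.+1 < split_level x y) by rewrite d ltnn.
have h4 : ~~ (k.+1 < split_level y z) by rewrite -e d ltnn.
move: h1 h2 h3 h4; rewrite !ltn_split_level !negbK expnSr !divnMA.
have := leq_div2r (2 ^ k) (ltnW xy); have := leq_div2r (2 ^ k) (ltnW yz).
lia.
Qed.

Lemma split_level_leq (N x y : nat) : x < 2 ^ N -> y < 2 ^ N -> split_level x y <= N.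
Proof. by move=> hx hy; rewrite leqNgt ltn_split_level !divn_small ?eqxx. Qed.

(* [T x y z] is meant for [x], [y], [z] in increasing order for [lt]; as
   [lt] may be [<] or [>], one argument serves both directions. *)
Lemma two_pairs_split (lt : rel nat) (d : nat -> nat -> nat)
    (T : nat -> nat -> nat -> Prop) (a b a' b' : nat) :
  transitive lt -> (forall x y, x != y -> lt x y || lt y x) ->
  (forall x y z, lt x y -> lt y z -> d x z = maxn (d x y) (d y z)) ->
  (forall x y z, T x y z -> d x y < d y z) ->
  let mono x y v := [/\ lt v x -> T v x y, lt x v -> lt v y -> T x v y
                      & lt y v -> T x y v] in
  lt a b -> lt a' b' -> uniq [:: a; b; a'; b'] ->
  mono a b a' -> mono a b b' -> mono a' b' a -> mono a' b' b ->
  d a' b' <= d a b -> T a' b' b /\ d b' b = d a b.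
Proof.
move=> tr tot dmax Td mono ab ab'; rewrite /= !inE !negb_or => U.
have {U} [nab' nba' nbb'] : [/\ a != b', b != a' & b != b'].
  by case/and4P: U => /and3P[_ _ ?] /andP[? ?] _ _.
move=> [_ _ aba'] [b'ab ab'b abb'] [aa'b' _ _] [_ a'bb' a'b'b] le.
(* If [b] came before [a'], then [d a b < d b a' = d a a' < d a' b'], contrary to [le]. *)
have [ba'|a'b] := orP (tot _ _ nba').
  have aa' := tr _ _ _ ab ba'.
  have := Td _ _ _ (aa'b' aa'); have := Td _ _ _ (aba' ba').
  by rewrite (dmax _ _ _ ab ba'); lia.
(* If [b] came before [b'], then [d a b < d b b' <= d a' b'], contrary to [le]. *)
have [bb'|b'b] := orP (tot _ _ nbb').
  have := Td _ _ _ (abb' bb'); have := Td _ _ _ (a'bb' a'b bb').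
  by move: le; rewrite (dmax _ _ _ a'b bb'); lia.
split; first exact: a'b'b.
have [lab'|b'a] := orP (tot _ _ nab').
  by have := Td _ _ _ (ab'b lab' b'b); rewrite (dmax _ _ _ lab' b'b); lia.
by have := Td _ _ _ (b'ab b'a); rewrite (dmax _ _ _ b'a ab); lia.
Qed.

(** * The hypergraph of pairs and its degrees *)

Definition pair_edge (q : nat) (i : 'I_q) (v : 'I_q * bool) : {set 'I_q * bool} :=
  [set (i, false); (i, true); v].

Definition pair_edges (q : nat) : {set {set 'I_q * bool}} :=
  [set e | [exists i, exists v, (v.1 != i) && (e == pair_edge i v)]].

Lemma pair_edgesP (q : nat) (e : {set 'I_q * bool}) :
  reflect (exists i v, v.1 != i /\ e = pair_edge i v) (e \in pair_edges q).
Proof.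
rewrite inE; apply: (iffP existsP) => [[i /existsP [v /andP [? /eqP ?]]]|[i [v [vi ->]]]].
  by exists i, v.
by exists i; apply/existsP; exists v; rewrite vi eqxx.
Qed.

Lemma pair_edges_uniform (q : nat) (e : {set 'I_q * bool}) :
  e \in pair_edges q -> #|e| = 3.
Proof.
move=> /pair_edgesP [i [[j b] [/= ji ->]]].
rewrite /pair_edge setUC cardsU1 cards2 !inE !xpair_eqE (negPf ji) /=.
by rewrite eqxx.
Qed.

Definition pair_hypergraph (q : nat) : hypergraph3 ('I_q * bool)%type :=
  Hypergraph3 (@pair_edges_uniform q).

(** An edge through [u] is the pair of [u] with one of at most [2 * q] vertices, or one of at most
    [q] pairs with [u] added. *)
Lemma max_degree_pair_hypergraph (q : nat) : max_degree (pair_hypergraph q) <= 3 * q.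
Proof.
apply/bigmax_leqP => u _; rewrite /degree /=.
set E1 := [set pair_edge u.1 v | v : 'I_q * bool].
set E2 := [set pair_edge i u | i : 'I_q].
apply: (@leq_trans #|E1 :|: E2|).
  apply/subset_leq_card/subsetP => e; rewrite inE.
  case/andP=> /pair_edgesP [i [v [_ ->]]] ue; rewrite inE.
  have [->|ne] := eqVneq v u; first by apply/orP; right; apply: imset_f.
  have -> : i = u.1.
    by move: ue; rewrite !inE (eq_sym u v) (negPf ne) orbF => /orP [] /eqP ->.
  by apply/orP; left; apply: imset_f.
apply: leq_trans (leq_card_setU _ _) _.
apply: leq_trans (leq_add (leq_imset_card _ _) (leq_imset_card _ _)) _.
by rewrite card_prod card_bool !card_ord; lia.
Qed.

(** * The stepping-up colouring *)

Definition sorted_triple_holds (P : nat -> nat -> nat -> bool) (M : nat)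
    (e : {set 'I_M}) : bool :=
  [exists x in e, exists y in e, exists z in e, [&& x < y, y < z & P x y z]].

Lemma sorted_triple_holdsE (P : nat -> nat -> nat -> bool) (M : nat)
    (e : {set 'I_M}) (x y z : 'I_M) : e = [set x; y; z] -> x < y -> y < z ->
  sorted_triple_holds P e = P x y z.
Proof.
move=> -> xy yz; apply/idP/idP => [|Pxyz]; last first.
  apply/exists_inP; exists x; rewrite ?inE ?eqxx //.
  apply/exists_inP; exists y; rewrite ?inE ?eqxx ?orbT //.
  apply/exists_inP; exists z; rewrite ?inE ?eqxx ?orbT //.
  by rewrite xy yz.
case/exists_inP=> x'; rewrite !inE => hx' /exists_inP [y']; rewrite !inE => hy'.
case/exists_inP=> z'; rewrite !inE => hz' /and3P [].
by case/orP: hx' => [/orP[]|] /eqP ->; case/orP: hy' => [/orP[]|] /eqP ->;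
  case/orP: hz' => [/orP[]|] /eqP -> //; lia.
Qed.

Lemma not_arrows4_pair_hypergraph (k M : nat) : M <= 2 ^ (2 ^ k).-1 ->
  ~~ arrows4 (pair_hypergraph (2 * k + 3)) M.
Proof.
move=> leM; have [chi chiP] := ramsey2_lower_bound k; set q := 2 * k + 3.
have pos : 0 < 2 ^ k by rewrite expn_gt0.
(* Numbers below [2 ^ (2 ^ k).-1] have levels from [0] to [(2 ^ k).-1], so the default is never
   taken. *)
pose lv m : 'I_(2 ^ k) := insubd (Ordinal pos) m.
pose d := split_level.
pose up x y z := d x y < d y z.
pose red x y z := chi [set lv (d x y); lv (d y z)].
(* The low bit of the colour is [up] and the high bit [red]; [u] and [r] decode them. *)
pose c : {ffun {set 'I_M} -> 'I_4} := [ffun e =>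
  inord (sorted_triple_holds up e + (sorted_triple_holds red e).*2)].
apply/negP => /forallP /(_ c) /existsP [f /andP [/injectiveP f_inj]].
case/existsP=> a /forall_inP mono.
pose u := odd a; pose r := (1 < a)%N.
have colour e : e \in pair_edges q ->
    sorted_triple_holds up (f @: e) = u /\ sorted_triple_holds red (f @: e) = r.
  move=> /mono /eqP; rewrite ffunE => /(congr1 val) /=.
  rewrite inordK; last by do 2!case: sorted_triple_holds.
  by rewrite /u /r => <-; do 2!case: sorted_triple_holds.
(* If levels decrease from left to right on the copy, they increase in the reversed order. *)
pose lt : rel nat := if u then ltn else gtn.
pose T x y z := d x y < d y z /\ chi [set lv (d x y); lv (d y z)] = r.
have lt_tr : transitive lt by rewrite /lt; case: (u) => x y z /=; lia.
have lt_tot x y : x != y -> lt x y || lt y x by rewrite /lt; case: (u) => /=; lia.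
have d_max x y z : lt x y -> lt y z -> d x z = maxn (d x y) (d y z).
  rewrite /lt /d; case: (u) => /= xy yz; first exact: split_level_max.
  by rewrite split_levelC (split_level_max yz xy) maxnC ![split_level z _]split_levelC
    (split_levelC y x).
have monoT x y z : [set x; y; z] \in pair_edges q ->
    lt (f x) (f y) -> lt (f y) (f z) -> T (f x) (f y) (f z).
  move=> /colour []; rewrite !imsetU !imset_set1 /lt /T /d.
  case: (u) => /= hu hr xy yz.
    rewrite (sorted_triple_holdsE _ erefl xy yz) in hu.
    by rewrite (sorted_triple_holdsE _ erefl xy yz) in hr.
  have e : [set f x; f y; f z] = [set f z; f y; f x].
    by apply/setP => w; rewrite !inE; do 3!case: (w == _).
  rewrite (sorted_triple_holdsE _ e yz xy) in hu.
  rewrite (sorted_triple_holdsE _ e yz xy) in hr.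
  split; last by rewrite (split_levelC (f x) (f y)) (split_levelC (f y) (f z)) setUC.
  (* Consecutive levels differ, so failing [up] means a strict decrease. *)
  move/negbT: hu; rewrite /up -leqNgt leq_eqVlt eq_sym.
  rewrite (negPf (split_level_neq yz xy)) /=.
  by rewrite /d (split_levelC (f x) (f y)) (split_levelC (f y) (f z)).
pose s i := lt (f (i, false)) (f (i, true)).
pose a_ i : nat := f (i, ~~ s i); pose b_ i : nat := f (i, s i).
have ab i : lt (a_ i) (b_ i).
  have ne : (f (i, false) : nat) != f (i, true).
    by apply/negP => /eqP /val_inj /f_inj [].
  by have := lt_tot _ _ ne; rewrite /a_ /b_ /s; case h: (lt (f (i, false)) _) => //=.
have edge i v x y z : v.1 != i -> [set x; y; z] = pair_edge i v ->
    [set x; y; z] \in pair_edges q.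
  by move=> vi e; apply/pair_edgesP; exists i, v.
(* The edge formed by pair [j] and [b_ i] gives both claims, as [b_ j] and [b_ i] split at the level
   of pair [i]. *)
have key i j : i != j -> d (a_ j) (b_ j) <= d (a_ i) (b_ i) ->
    d (a_ j) (b_ j) < d (a_ i) (b_ i) /\
    chi [set lv (d (a_ i) (b_ i)); lv (d (a_ j) (b_ j))] = r.
  move=> ij le.
  have M3 (i' j' : 'I_q) t : i' != j' -> let v : nat := f (j', t) in
      [/\ lt v (a_ i') -> T v (a_ i') (b_ i'),
          lt (a_ i') v -> lt v (b_ i') -> T (a_ i') v (b_ i')
        & lt (b_ i') v -> T (a_ i') (b_ i') v].
    move=> ij' v; have ji' : (j', t).1 != i' by rewrite eq_sym.
    have abi := ab i'; split=> *; apply: monoT => //; apply: (edge _ _ _ _ _ ji');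
    rewrite /pair_edge; case: (s i') => /=;
    by apply/setP => w; rewrite !inE; do 3!case: (w == _).
  have ji : j != i by rewrite eq_sym.
  have U : uniq [:: a_ i; b_ i; a_ j; b_ j].
    rewrite (map_inj_uniq (f := fun v => f v : nat) _
      [:: (i, ~~ s i); (i, s i); (j, ~~ s j); (j, s j)]) /=.
      rewrite !inE !xpair_eqE !eqxx (negPf ij) /= andbT !orbF.
      by case: (s i); case: (s j).
    by move=> v w /val_inj /f_inj.
  have [[h1 h2] h3] := two_pairs_split lt_tr lt_tot d_max
    (fun x y z (h : T x y z) => proj1 h) (ab i) (ab j) U
    (M3 _ _ _ ij) (M3 _ _ _ ij) (M3 _ _ _ ji) (M3 _ _ _ ji) le.
  by rewrite h3 in h1 h2; rewrite setUC.
have d_lt i : d (a_ i) (b_ i) < 2 ^ k.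
  rewrite -(ltn_predK pos) ltnS; apply: split_level_leq;
  exact: leq_trans (ltn_ord _) leM.
(* The levels of the [q] pairs are the clique that [chiP] forbids. *)
pose g : {ffun 'I_q -> 'I_(2 ^ k)} := [ffun i => lv (d (a_ i) (b_ i))].
have sym i j : i != j -> d (a_ i) (b_ i) != d (a_ j) (b_ j) /\
    chi [set g i; g j] = r.
  move=> ij; rewrite !ffunE.
  have [le|/ltnW le] := leqP (d (a_ j) (b_ j)) (d (a_ i) (b_ i)).
    by have [h1 h2] := key _ _ ij le; split=> //; rewrite neq_ltn h1 orbT.
  rewrite eq_sym in ij; have [h1 h2] := key _ _ ij le.
  by split; [rewrite neq_ltn h1|rewrite setUC].
apply: (chiP g r) => [i j|i j /sym [] //].
rewrite !ffunE => /(congr1 val); rewrite !val_insubd !d_lt => e.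
by apply: contraTeq (eqxx (d (a_ i) (b_ i))) => /sym [+ _]; rewrite -e eqxx.
Qed.

Lemma ramsey4_pair_hypergraph (k : nat) :
  2 ^ (2 ^ k).-1 < ramsey4 (pair_hypergraph (2 * k + 3)).
Proof.
rewrite /ramsey4; case: ex_minnP => M arr _; rewrite ltnNge.
by apply: contraL arr => /not_arrows4_pair_hypergraph.
Qed.

(** * Numerical estimates and conclusion *)

(** From [k = 5] on, the number of vertices is at most [2 ^ k], and the exponents leave room for
    this factor: [2 ^ k.-1 + k <= (2 ^ k).-1]. *)
Lemma double_exp_slack (k : nat) : 5 <= k ->
  2 ^ 2 ^ k.-1 * ((2 * k + 3) * 2) <= 2 ^ (2 ^ k).-1.
Proof.
move=> k5; have lin : (2 * k + 3) * 2 <= 2 ^ k.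
  elim: k k5 => // k IH; rewrite leq_eqVlt => /orP [/eqP <- //|/IH].
  by rewrite expnS; lia.
apply: leq_trans (leq_mul (leqnn _) lin) _; rewrite -expnD leq_exp2l //.
by move: lin k5; case: k => // k; rewrite expnS /=; lia.
Qed.

From mathcomp Require Import all_classical all_reals all_analysis.

Import Order.TTheory GRing.Theory Num.Theory.

Local Open Scope ring_scope.

Theorem theorem6 (R : realType) :
  exists2 c : R, 0 < c &
    exists Delta0 : nat, forall Delta : nat, (Delta0 <= Delta)%N ->
      exists (V : finType) (H : hypergraph3 V),
        [/\ (0 < #|V|)%N,
            (max_degree H <= Delta)%N &
            2 `^ (2 `^ (c * Delta%:R)) * #|V|%:R <= (ramsey4 H)%:R :> R].
Proof.
exists 12^-1; first by rewrite invr_gt0 ltr0n.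
(* This is the largest [k] with [3 * (2 * k + 3) <= Delta]; from [100] on, [5 <= k] and
   [Delta <= 12 * k.-1], whence the constant [1 / 12]. *)
exists 100%N => Delta Delta_ge; pose k := ((Delta - 9) %/ 6)%N.
have cardV : #|{: 'I_(2 * k + 3) * bool}| = ((2 * k + 3) * 2)%N.
  by rewrite card_prod card_ord card_bool.
exists ('I_(2 * k + 3) * bool)%type, (pair_hypergraph (2 * k + 3)).
split; first by rewrite cardV; lia.
  by apply: leq_trans (max_degree_pair_hypergraph _) _; rewrite /k; lia.
have le2 : 1 <= 2 :> R by rewrite ler1n.
apply: (@le_trans _ _ (2 ^ 2 ^ k.-1 * ((2 * k + 3) * 2))%N%:R); last first.
  rewrite ler_nat; apply: leq_trans (ltnW (ramsey4_pair_hypergraph k)).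
  by apply: double_exp_slack; rewrite /k; lia.
rewrite cardV [leRHS]natrM ler_wpM2r // [leRHS]natrX -powR_mulrn // ler_powR //.
rewrite [leRHS]natrX -powR_mulrn // ler_powR // mulrC ler_pdivrMr ?ltr0n //.
by rewrite -natrM ler_nat /k; lia.
Qed.
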